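(* Let $k$ be a field, let $A$ be a unital associative $k$-algebra, and let $(\partial,\sigma)$ be a right twisted multi-derivation in $A$ such that $\sigma$, viewed as an element of $M_n(\mathrm{End}_k(A))$, is an upper-triangular matrix with non-zero diagonal entries. Then $(\partial,\sigma)$ is a free right twisted multi-derivation with $\bar\sigma$ a lower-triangular matrix if and only if the diagonal entries $\sigma_{ii}$, $i=1,\dots,n$, of $\sigma$ are invertible (as elements of $\mathrm{End}_k(A)$).
   Context: A right twisted multi-derivation in $A$ is a pair $(\partial,\sigma)$, where $\sigma:A\to M_n(A)$, $\sigma(a)=(\sigma_{ij}(a))_{i,j=1}^n$, is an algebra homomorphism and $\partial:A\to A^n$, $\partial(a)=(\partial_i(a))_{i=1}^n$, is a $k$-linear map such that $\partial_i(ab)=\sum_j\partial_j(a)\sigma_{ji}(b)+a\partial_i(b)$ for all $a,b\in A$ and $i=1,\dots,n$. A $k$-linear map $\sigma:A\to M_n(A)$ is viewed as an element $(\sigma_{ij})$ of $M_n(\mathrm{End}_k(A))$, where $\mathrm{End}_k(A)$ is the algebra of $k$-linear endomorphisms of $A$. Write $\bullet$ for the product in $M_n(\mathrm{End}_k(A))$, i.e. $(\alpha\bullet\beta)_{ij}=\sum_k\alpha_{ik}\circ\beta_{kj}$, $\mathbb{I}$ for its unit, and $\sigma^T$ for the transpose, $(\sigma^T)_{ij}=\sigma_{ji}$. A right twisted multi-derivation $(\partial,\sigma)$ is free if there exist algebra maps $\bar\sigma:A\to M_n(A)$ and $\hat\sigma:A\to M_n(A)$ such that $\bar\sigma\bullet\sigma^T=\mathbb{I}$,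 $\sigma^T\bullet\bar\sigma=\mathbb{I}$, $\hat\sigma\bullet\bar\sigma^T=\mathbb{I}$, $\bar\sigma^T\bullet\hat\sigma=\mathbb{I}$. *)

(* Defs.v *)
From HB Require Import structures.
From mathcomp Require Import all_boot all_order all_algebra.
From mathcomp Require Import boolp.
Set Implicit Arguments.
Unset Strict Implicit.
Unset Printing Implicit Defensive.
Import GRing.Theory.
Local Open Scope ring_scope.

(* End_k(A). The algebra A may be infinite-dimensional, so 'End of vector.v
   does not apply; the decidable equality and the choice operator that ring
   structures require are classical. *)
Definition kEnd (k : fieldType) (A : algType k) : Type := {linear A -> A}.

Section KEndRing.
Variables (k : fieldType) (A : algType k).
Implicit Types f g h : kEnd A.

Definition kEnd_fun f : A -> A := f : {linear A -> A}.
Coercion kEnd_fun : kEnd >-> Funclass.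

HB.instance Definition _ := gen_eqMixin (kEnd A).
HB.instance Definition _ := gen_choiceMixin (kEnd A).

Lemma kEndP f g : f =1 g -> f = g.
Proof.
case: f g => f [[fD] [fZ]] [g [[gD] [gZ]]] /= fg.
have {}fg : f = g by apply: funext.
subst g; congr GRing.Linear.Pack; congr GRing.Linear.Class.
- by congr GRing.isNmodMorphism.Axioms_; apply: Prop_irrelevance.
- by congr GRing.isScalable.Axioms_; apply: Prop_irrelevance.
Qed.

Definition kEnd_zero : kEnd A := \0 : {linear A -> A}.
Definition kEnd_opp f : kEnd A := \- (f : {linear A -> A}) : {linear A -> A}.
Definition kEnd_add f g : kEnd A :=
  (f : {linear A -> A}) \+ (g : {linear A -> A}) : {linear A -> A}.
Definition kEnd_one : kEnd A := idfun : {linear A -> A}.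
Definition kEnd_mul f g : kEnd A :=
  (f : {linear A -> A}) \o (g : {linear A -> A}) : {linear A -> A}.

Fact kEnd_addA : associative kEnd_add.
Proof. by move=> f g h; apply: kEndP => a; apply: addrA. Qed.
Fact kEnd_addC : commutative kEnd_add.
Proof. by move=> f g; apply: kEndP => a; apply: addrC. Qed.
Fact kEnd_add0 : left_id kEnd_zero kEnd_add.
Proof. by move=> f; apply: kEndP => a; apply: add0r. Qed.
Fact kEnd_addN : left_inverse kEnd_zero kEnd_opp kEnd_add.
Proof. by move=> f; apply: kEndP => a; apply: addNr. Qed.

HB.instance Definition _ := GRing.isZmodule.Build (kEnd A)
  kEnd_addA kEnd_addC kEnd_add0 kEnd_addN.

Fact kEnd_mulA : associative kEnd_mul.
Proof. by move=> f g h; apply: kEndP. Qed.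
Fact kEnd_mul1 : left_id kEnd_one kEnd_mul.
Proof. by move=> f; apply: kEndP. Qed.
Fact kEnd_mulr1 : right_id kEnd_one kEnd_mul.
Proof. by move=> f; apply: kEndP. Qed.
Fact kEnd_mulDl : left_distributive kEnd_mul +%R.
Proof. by move=> f g h; apply: kEndP. Qed.
Fact kEnd_mulDr : right_distributive kEnd_mul +%R.
Proof. by move=> f g h; apply: kEndP => a; apply: (raddfD (f : {linear A -> A})). Qed.
Fact kEnd_1neq0 : kEnd_one != 0.
Proof.
apply/eqP => /(congr1 (fun f : kEnd A => f 1)) /= /eqP.
by apply/negP; apply: oner_neq0.
Qed.

HB.instance Definition _ := GRing.Zmodule_isNzRing.Build (kEnd A)
  kEnd_mulA kEnd_mul1 kEnd_mulr1 kEnd_mulDl kEnd_mulDr kEnd_1neq0.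

End KEndRing.

Definition invertible (R : nzRingType) (x : R) : Prop :=
  exists y : R, y * x = 1 /\ x * y = 1.

(* MathComp provides no k-module structure on 'M[A]_(m, n), only the left
   A-module one; the scaling in_alg A \; *:%R sends c and M to (c *: 1) *: M,
   whose entries are c *: M i j. *)
Notation "{ 'klinear' A -> 'M_ ( m , n ) }" :=
  {linear A -> 'M[A]_(m, n) | in_alg A \; *:%R}
  (at level 0, A at level 98, m, n at level 9) : type_scope.
Notation "{ 'algmap' A -> 'M_ n }" :=
  {lrmorphism A -> 'M[A]_n | in_alg A \; *:%R}
  (at level 0, A at level 98, n at level 2) : type_scope.

Section MatrixOfEnd.
Variables (k : fieldType) (A : algType k) (n : nat).

Definition entry (s : {algmap A -> 'M_n}) (i j : 'I_n) (a : A) : A := s a i j.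

Fact entry_is_linear s i j : linear (entry s i j).
Proof. by move=> c a b; rewrite /entry linearP !mxE mulr_algl. Qed.

HB.instance Definition _ s i j := GRing.isLinear.Build k A A _ (entry s i j)
  (entry_is_linear s i j).

(* The view of s : A -> M_n(A) as an element of M_n(End_k(A)). In the ring
   'M[kEnd A]_n the product of the text is *m, and its unit is 1%:M. *)
Definition endmx (s : {algmap A -> 'M_n}) : 'M[kEnd A]_n :=
  \matrix_(i, j) (entry s i j : {linear A -> A}).

End MatrixOfEnd.

Record rtmd (k : fieldType) (A : algType k) (n : nat) := RTMD {
  rtmd_der : {klinear A -> 'M_(1, n)};
  rtmd_hom : {algmap A -> 'M_n};
  rtmd_leibniz : forall (a b : A) (i : 'I_n),
    rtmd_der (a * b) 0 i =
      \sum_j rtmd_der a 0 j * rtmd_hom b j i + a * rtmd_der b 0 i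
}.

(* D is free if free_with D sb for some sb; the lower-triangularity condition
   of the theorem bears on the same sb. *)
Definition free_with (k : fieldType) (A : algType k) (n : nat)
    (D : rtmd A n) (sb : {algmap A -> 'M_n}) : Prop :=
  exists sh : {algmap A -> 'M_n},
    [/\ endmx sb *m (endmx (rtmd_hom D))^T = 1%:M,
        (endmx (rtmd_hom D))^T *m endmx sb = 1%:M,
        endmx sh *m (endmx sb)^T = 1%:M
      & (endmx sb)^T *m endmx sh = 1%:M].

(* is_trig_mx M says that M i j = 0 whenever i < j. *)
Definition lower_triangular (R : nmodType) (n : nat) (M : 'M[R]_n) : Prop :=
  is_trig_mx M.

Definition upper_triangular (R : nmodType) (n : nat) (M : 'M[R]_n) : Prop :=
  is_trig_mx M^T.

(* Main.v *)
From HB Require Import structures.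
Require Import Defs.
From mathcomp Require Import all_boot all_order all_algebra.
Import GRing.Theory.
Local Open Scope ring_scope.

(** Two facts of independent nature meet here.

    The first holds for every algebra map [s : A -> M_n(A)], triangular or not:
    if [T] is a two-sided inverse of the transpose of [s] in [M_n(End_k(A))],
    then [T] is an algebra map as well ([inverse_tr_algmap]).  Indeed the
    relation [\sum_i s_il (T_ij a) = delta_lj a] and the multiplicativity of
    [s] give
      [\sum_i s_il (\sum_m T_im a * T_mj b)
         = \sum_(m, p) (\sum_i s_ip (T_im a)) * s_pl (T_mj b)
         = a * \sum_m s_ml (T_mj b) = delta_lj (a * b)
         = \sum_i s_il (T_ij (a * b))],
    and a vector [u] over [A] is determined by the values
    [\sum_i s_il (u_i)], since [T] is a left inverse of the transpose of [s].

    The second is linear algebra over the noncommutative ring [End_k(A)]: a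
    triangular matrix with invertible diagonal entries has a two-sided inverse
    ([trig_inverse], [trmx_trig_inverse]), and conversely if a triangular
    matrix has an inverse of the same shape, then their diagonals are inverse
    to each other ([trig_inverse_diag]).

    So freeness only asks for matrix inverses.  If the [sigma_ii] are
    invertible, invert the transpose of [sigma] to get a lower-triangular
    [sigma-bar]; its diagonal is invertible, hence so is the upper-triangular
    transpose of [sigma-bar], whose inverse is [sigma-hat]. *)

Set Implicit Arguments.
Unset Strict Implicit.
Unset Printing Implicit Defensive.

(** * Inverses of triangular matrices over a noncommutative ring *)

Lemma trig_mulmx_diag (R : nzRingType) (n : nat) (M N : 'M[R]_n) (i : 'I_n) :
  is_trig_mx M -> is_trig_mx N -> (M *m N) i i = M i i * N i i.
Proof.
move=> /is_trig_mxP Mtrig /is_trig_mxP Ntrig.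
rewrite mxE (bigD1 i) //= big1 ?addr0 // => j neq_ji.
case: (ltngtP i j) => [lt_ij|lt_ji|/val_inj eq_ij].
- by rewrite Mtrig ?mul0r.
- by rewrite Ntrig ?mulr0.
- by rewrite eq_ij eqxx in neq_ji.
Qed.

Lemma trig_inverse_diag (R : nzRingType) (n : nat) (M N : 'M[R]_n) :
  is_trig_mx M -> is_trig_mx N -> N *m M = 1%:M -> M *m N = 1%:M ->
  forall i, N i i * M i i = 1 /\ M i i * N i i = 1.
Proof.
move=> Mtrig Ntrig NM MN i.
by rewrite -!trig_mulmx_diag // NM MN !mxE eqxx.
Qed.

(** Determinants make no sense over [R], so the inverse is built by blocks,
    splitting off the first row and column. *)
Lemma trig_inverse (R : nzRingType) (n : nat) (M : 'M[R]_n) :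
  is_trig_mx M -> (forall i, invertible (M i i)) ->
  exists N : 'M[R]_n, [/\ is_trig_mx N, N *m M = 1%:M & M *m N = 1%:M].
Proof.
move: n M; apply: trigsqmx_ind => [_|n x c M Mtrig IHn blockdiag].
  by exists 0; split; [apply: mx0_is_trig | |]; apply/matrixP=> -[].
have [y [yx xy]] : invertible (x 0 0).
  by have := blockdiag (lshift n 0); rewrite block_mxEul.
have [|N [Ntrig NM MN]] := IHn.
  by move=> i; have := blockdiag (rshift 1 i); rewrite block_mxEdr.
have yx1 : y%:M *m x = 1%:M :> 'M_1.
  by rewrite [x]mx11_scalar -scalar_mxM yx.
have xy1 : x *m y%:M = 1%:M :> 'M_1.
  by rewrite [x]mx11_scalar -scalar_mxM xy.
exists (block_mx y%:M 0 (- (N *m c *m y%:M)) N); split.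
- by rewrite is_trig_block_mx // eqxx mx11_is_trig.
- rewrite mulmx_block !(mul0mx, mulmx0, addr0, add0r) mulNmx
    -(mulmxA (N *m c)).
  by rewrite yx1 mulmx1 addNr NM -scalar_mx_block.
- rewrite mulmx_block !(mul0mx, mulmx0, addr0, add0r) mulmxN !mulmxA.
  by rewrite MN mul1mx subrr xy1 -scalar_mx_block.
Qed.

(** Upper-triangular matrices become lower-triangular over the converse ring,
    where transposition reverses products. *)
Lemma trmx_trig_inverse (R : nzRingType) (n : nat) (M : 'M[R]_n) :
  is_trig_mx M^T -> (forall i, invertible (M i i)) ->
  exists N : 'M[R]_n, N *m M = 1%:M /\ M *m N = 1%:M.
Proof.
move=> Mtrig Mdiag.
have [|N [_ NM MN]] := @trig_inverse R^c n M^T Mtrig.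
  by move=> i; have [y [yx xy]] := Mdiag i; exists y; rewrite mxE.
exists (N : 'M[R]_n)^T; split; apply: trmx_inj.
- by rewrite trmx_mul_rev trmxK tr_scalar_mx.
- by rewrite trmx_mul_rev trmxK tr_scalar_mx.
Qed.

(** * Evaluating matrices of endomorphisms *)

(** An endomorphism [f : kEnd A] is applied to elements of [A] through
    [kEnd_fun], so the lemmas on linear maps have to find a structure there. *)
HB.instance Definition _ (k : fieldType) (A : algType k) (f : kEnd A) :=
  GRing.Linear.copy (kEnd_fun f) (f : {linear A -> A}).

Lemma kEnd_sumE (k : fieldType) (A : algType k) (I : finType)
    (f : I -> kEnd A) (a : A) :
  (\sum_i f i : kEnd A) a = \sum_i f i a.
Proof. exact: (big_morph (fun g : kEnd A => g a)). Qed.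

Lemma mulmx_kEndE (k : fieldType) (A : algType k) (n : nat)
    (M N : 'M[kEnd A]_n) (i j : 'I_n) (a : A) :
  ((M *m N) i j : kEnd A) a = \sum_l M i l (N l j a).
Proof. by rewrite mxE kEnd_sumE. Qed.

Lemma kEnd_mx1E (k : fieldType) (A : algType k) (n : nat) (i j : 'I_n) (a : A) :
  ((1%:M : 'M[kEnd A]_n) i j : kEnd A) a = a *+ (i == j).
Proof. by rewrite mxE; case: eqP. Qed.

Lemma endmxE (k : fieldType) (A : algType k) (n : nat) (s : {algmap A -> 'M_n})
    (i j : 'I_n) (a : A) :
  (endmx s i j : kEnd A) a = s a i j.
Proof. by rewrite mxE. Qed.

Definition eval_mx (k : fieldType) (A : algType k) (n : nat)
    (T : 'M[kEnd A]_n) (a : A) : 'M[A]_n := \matrix_(i, j) T i j a.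

(** * The inverse of the transpose of an algebra map *)

Section InverseTranspose.
Variables (k : fieldType) (A : algType k) (n : nat).
Variables (s : {algmap A -> 'M_n}) (T : 'M[kEnd A]_n).
Hypothesis Ts : T *m (endmx s)^T = 1%:M.
Hypothesis sT : (endmx s)^T *m T = 1%:M.

Lemma sum_hom_inverse (l j : 'I_n) (a : A) :
  \sum_i s (T i j a) i l = a *+ (l == j).
Proof.
rewrite -kEnd_mx1E -sT.
rewrite mulmx_kEndE.
by apply: eq_bigr => i _; rewrite mxE endmxE.
Qed.

Lemma sum_inverse_hom (i m : 'I_n) (a : A) :
  \sum_l T i l (s a m l) = a *+ (i == m).
Proof.
rewrite -kEnd_mx1E -Ts mulmx_kEndE.
by apply: eq_bigr => l _; rewrite [_^T _ _]mxE endmxE.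
Qed.

(** Equations between vectors over [A] can be tested after applying the
    transpose of [s]; this turns statements on [T] into statements on [s]. *)
Lemma hom_tr_inj (u v : 'I_n -> A) :
  (forall l, \sum_i s (u i) i l = \sum_i s (v i) i l) -> u =1 v.
Proof.
have T_recovers w i : \sum_l T i l (\sum_m s (w m) m l) = w i.
  under eq_bigr => l _ do rewrite raddf_sum.
  rewrite exchange_big /= -[RHS](mulr1n (w i)).
  under eq_bigr => m _ do rewrite sum_inverse_hom.
  rewrite (bigD1 i) //= eqxx big1 ?addr0 // => m /negPf.
  by rewrite eq_sym => ->.
by move=> uv i; rewrite -T_recovers -[RHS]T_recovers; under eq_bigr do rewrite uv.
Qed.

Lemma eval_mx_linear : linear_for (in_alg A \; *:%R) (eval_mx T).
Proof.
move=> c a b; apply/matrixP => i j; rewrite !mxE /=.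
by rewrite linearP mulr_algl.
Qed.

Lemma eval_mx_monoid : monoid_morphism (eval_mx T).
Proof.
split.
  apply/matrixP => i j; rewrite mxE [RHS]mxE.
  apply: (hom_tr_inj (u := fun i => T i j 1) (v := fun i => (i == j)%:R)).
  move=> l; rewrite sum_hom_inverse (bigD1 j) //= eqxx big1 ?addr0.
    by rewrite rmorph1 mxE eq_sym.
  by move=> m /negPf->; rewrite raddf0 mxE.
move=> a b; apply/matrixP => i j; rewrite !mxE.
apply: (hom_tr_inj (u := fun i => T i j (a * b))
  (v := fun i => \sum_m eval_mx T a i m * eval_mx T b m j)).
move=> {i} l; rewrite sum_hom_inverse.
(* Both sides expand to this sum: the inner sum over i is a when m = p, else 0. *)
transitivity (\sum_m \sum_p (\sum_i s (T i m a) i p) * s (T m j b) p l).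
  under eq_bigr => m _ do under eq_bigr => p _ do rewrite sum_hom_inverse.
  rewrite -mulrnAr -sum_hom_inverse mulr_sumr; apply: eq_bigr => m _.
  rewrite (bigD1 m) //= eqxx big1 ?addr0 // => p /negPf->.
  by rewrite mul0r.
under [RHS]eq_bigr => i _ do rewrite raddf_sum summxE.
rewrite [RHS]exchange_big; apply: eq_bigr => m _ /=.
under [RHS]eq_bigr => i _ do rewrite rmorphM mxE.
rewrite [RHS]exchange_big; apply: eq_bigr => p _ /=.
by rewrite mulr_suml; apply: eq_bigr => i _; rewrite !mxE.
Qed.

(** The four equations in the definition of freeness say that each of the two
    maps is a two-sided inverse of a transpose; this lemma reduces their
    existence to that of inverse matrices. *)
Lemma inverse_tr_algmap : exists t : {algmap A -> 'M_n}, endmx t = T.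
Proof.
pose linT := GRing.isLinear.Build k A 'M[A]_n _ (eval_mx T) eval_mx_linear.
pose monT := GRing.isMonoidMorphism.Build A 'M[A]_n (eval_mx T) eval_mx_monoid.
pose t : {algmap A -> 'M_n} := HB.pack (eval_mx T) linT monT.
exists t; apply/matrixP => i j; apply: kEndP => a.
by rewrite endmxE mxE.
Qed.

End InverseTranspose.

Unset Implicit Arguments.

Theorem proposition3p3 (k : fieldType) (A : algType k) (n : nat)
    (D : rtmd A n)
    (Dupper : upper_triangular (endmx (rtmd_hom D)))
    (Ddiag : forall i : 'I_n, endmx (rtmd_hom D) i i != 0) :
  (exists sb : {algmap A -> 'M_n},
     free_with D sb /\ lower_triangular (endmx sb))
  <-> (forall i : 'I_n, invertible (endmx (rtmd_hom D) i i)).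
Proof.
split=> [[sb [[sh [sbs ssb _ _]] sb_low]] i|s_diag].
  have := trig_inverse_diag Dupper sb_low sbs ssb i.
  by rewrite [_^T _ _]mxE; exists (endmx sb i i).
have [|T [Ttrig Ts sT]] := trig_inverse Dupper.
  by move=> i; rewrite mxE.
have [sb sbE] := inverse_tr_algmap Ts sT.
have sb_diag i : invertible ((endmx sb)^T i i).
  exists ((endmx (rtmd_hom D))^T i i); rewrite [(endmx sb)^T _ _]mxE sbE.
  by apply: (trig_inverse_diag Ttrig Dupper).
have [|U [Usb sbU]] := @trmx_trig_inverse _ _ (endmx sb)^T _ sb_diag.
  by rewrite trmxK sbE.
have [sh shE] := inverse_tr_algmap Usb sbU.
exists sb; split; last by rewrite sbE.
by exists sh; rewrite shE; split; rewrite // sbE.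
Qed.
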